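(* Let $r\ge1$ be an integer. For every $g\in C^{r}[c,d]$ and every $y\in[c,d]$, the quantity $$\widetilde{T}_{n,r}(g,y)=\frac{\sum_{k=0}^{n}\sigma\!\left(\frac{2m}{d_1}(y-z_k)\right)P_r(g;y,z_k)}{\sum_{k=0}^{n}\sigma\!\left(\frac{2m}{d_1}(y-z_k)\right)}$$ is well defined, i.e. its denominator $\sum_{k=0}^{n}\sigma\!\left(\frac{2m}{d_1}(y-z_k)\right)$ is nonzero.
   Context: Setting. $[c,d]\subset\mathbb{R}$ is a compact interval, functions are real-valued, and $C^{r}[c,d]$ is the space of functions whose derivatives up to order $r$ exist and are continuous on $[c,d]$. Irregular grid. $c=z_0<z_1<\cdots<z_n=d$ is a partition with $0<d_1\le z_{k+1}-z_k\le d_2$ for $k=0,\dots,n-1$, where $d_2<2d_1$; here $d_1=\min_k(z_{k+1}-z_k)$ is the minimum mesh size. Activation. For $m>0$, $D(m)$ is the class of measurable functions $\eta:\mathbb{R}\to\mathbb{R}$ that are increasing (i.e. non-decreasing), with $\eta(y)=0$ for $y\le -m$, $\eta(y)=1$ for $y\ge m$, and $0<\eta(y)<1$ for $-m<y<m$. Fix $\eta\in D(m)$ and put $\sigma(y):=\eta(y+m)-\eta(y-m)$, $y\in\mathbb{R}$. Taylor polynomial. $P_r(g;y,z_k):=\sum_{j=0}^{r}\frac{g^{(j)}(z_k)}{j!}(y-z_k)^j$. *)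

(* Defs.v *)
From mathcomp Require Import all_boot all_order all_algebra.
From mathcomp Require Import all_classical all_reals all_analysis.
Import Order.TTheory GRing.Theory Num.Theory.
Import numFieldNormedType.Exports.

Set Implicit Arguments.
Unset Strict Implicit.
Unset Printing Implicit Defensive.

Local Open Scope classical_set_scope.
Local Open Scope ring_scope.

Section RelativeDerivatives.
Variable R : realType.
Implicit Types (A : set R) (f : R -> R) (x : R).

(* Derivatives are taken relative to A: the increments x + h must stay in A,
   so that they are one-sided at the endpoints when A is a compact interval.
   For x in such an A, values of f outside of A play no role. *)
Definition nbhs_in A x := within A (x^').

Definition diff_quotient f x : R -> R := fun u => (f u - f x) / (u - x).

Definition derivable_in A f x : Prop :=
  cvg (diff_quotient f x u @[u --> nbhs_in A x]).

Definition derive_in A f : R -> R :=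
  fun x => lim (diff_quotient f x u @[u --> nbhs_in A x]).

Definition derive_in_n A (j : nat) f : R -> R := iter j (derive_in A) f.

Definition class_C (r : nat) (c d : R) f : Prop :=
  (forall j x, (j < r)%N -> x \in `[c, d] ->
     derivable_in `[c, d] (derive_in_n `[c, d] j f) x) /\
  (forall j, (j <= r)%N ->
     {within `[c, d], continuous (derive_in_n `[c, d] j f)}).

Definition taylor_poly (c d : R) (r : nat) (g : R -> R) (y z : R) : R :=
  \sum_(j < r.+1) derive_in_n `[c, d] j g z / (j`!)%:R * (y - z) ^+ j.

End RelativeDerivatives.

(* The nodes are z 0, ..., z n; values of z beyond n are irrelevant.
   The last two fields on d1 say that it is the minimum of the mesh sizes;
   in particular n > 0 and c < d. *)
Record irregular_grid (R : realType) (c d : R) (n : nat) (z : nat -> R)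
    (d1 d2 : R) : Prop := IrregularGrid {
  grid_first : z 0%N = c;
  grid_last : z n = d;
  grid_mesh_gt0 : 0 < d1;
  grid_mesh_le : forall k, (k < n)%N -> z k.+1 - z k <= d2;
  grid_mesh_ratio : d2 < 2 * d1;
  grid_mesh_ge : forall k, (k < n)%N -> d1 <= z k.+1 - z k;
  grid_mesh_min : exists2 k, (k < n)%N & z k.+1 - z k = d1
}.

Record class_D (R : realType) (m : R) (eta : R -> R) : Prop := ClassD {
  class_D_measurable : measurable_fun [set: R] eta;
  class_D_nondecreasing : {homo eta : x y / x <= y};
  class_D_eq0 : forall y, y <= - m -> eta y = 0;
  class_D_eq1 : forall y, m <= y -> eta y = 1;
  class_D_in01 : forall y, - m < y < m -> 0 < eta y < 1
}.

Definition sigma_of (R : realType) (m : R) (eta : R -> R) (y : R) : R :=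
  eta (y + m) - eta (y - m).

(* Division is total on R (x / 0 = 0), so a quotient whose definedness is at
   stake is kept as a formal one. *)
Record quotient (R : realType) := Quotient { numer : R; denom : R }.

Definition well_defined (R : realType) (q : quotient R) : Prop :=
  denom q != 0.

Definition Ttilde (R : realType) (c d m : R) (eta : R -> R) (n : nat)
    (z : nat -> R) (d1 : R) (r : nat) (g : R -> R) (y : R) : quotient R :=
  let weight k := sigma_of m eta (2 * m / d1 * (y - z k)) in
  Quotient
    (\sum_(0 <= k < n.+1) weight k * taylor_poly c d r g y (z k))
    (\sum_(0 <= k < n.+1) weight k).

(* Main.v *)
Require Import Defs.
From mathcomp Require Import all_boot all_order all_algebra.
From mathcomp Require Import all_classical all_reals all_analysis.
From mathcomp Require Import lra.
Import Order.TTheory GRing.Theory Num.Theory.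
Import numFieldNormedType.Exports.

Local Open Scope classical_set_scope.
Local Open Scope ring_scope.

(** The weight sigma is nonnegative everywhere and positive on (-2m, 2m). Since
    consecutive nodes are at distance at most d2 < 2 d1, the node nearest to y
    is at distance less than d1; its weight is then positive, and so is the
    sum of all the weights. *)

Lemma sigma_of_ge0 {R : realType} {m : R} {eta : R -> R} {u : R} :
  0 < m -> class_D m eta -> 0 <= sigma_of m eta u.
Proof.
move=> m0 [_ eta_nd _ _ _].
by rewrite subr_ge0; apply: eta_nd; lra.
Qed.

Lemma class_D_gt0 {R : realType} {m : R} {eta : R -> R} {u : R} :
  class_D m eta -> - m < u -> 0 < eta u.
Proof.
move=> [_ _ _ eta1 eta01] mu; case: (leP m u) => um; first by rewrite eta1.
by have /andP[] : 0 < eta u < 1 by apply: eta01; rewrite mu um.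
Qed.

Lemma class_D_lt1 {R : realType} {m : R} {eta : R -> R} {u : R} :
  class_D m eta -> u < m -> eta u < 1.
Proof.
move=> [_ _ eta0 _ eta01] um; case: (leP u (- m)) => mu; first by rewrite eta0.
by have /andP[] : 0 < eta u < 1 by apply: eta01; rewrite mu um.
Qed.

(** The sign of [u] decides which term is constant: for [u <= 0], [eta (u - m) = 0] and
    [u + m > - m]; for [u > 0], [eta (u + m) = 1] and [u - m < m]. *)
Lemma sigma_of_gt0 {R : realType} {m : R} {eta : R -> R} {u : R} :
  class_D m eta -> `|u| < 2 * m -> 0 < sigma_of m eta u.
Proof.
move=> eta_D; rewrite ltr_norml => /andP[mu um]; rewrite /sigma_of subr_gt0.
case: (leP u 0) => u0.
  rewrite (class_D_eq0 eta_D (y := u - m)); last by lra.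
  by apply: (class_D_gt0 eta_D); lra.
rewrite (class_D_eq1 eta_D (y := u + m)); last by lra.
by apply: (class_D_lt1 eta_D); lra.
Qed.

(** Induction on [n]: either the last interval contains [y], or [y] lies strictly before its left
    end and the earlier nodes still bracket [y]. *)
Lemma exists_mesh_interval {R : realType} {z : nat -> R} {n : nat} {y : R} :
  (0 < n)%N -> z 0%N <= y <= z n ->
  exists2 k, (k < n)%N & z k <= y <= z k.+1.
Proof.
elim: n => // n IHn _ /andP[z0y yz].
case: (leP (z n) y) => zny; first by exists n; rewrite ?zny.
(* With a single interval, [y < z 0] would contradict the lower bound on [y]. *)
case: n => [|n] in IHn yz zny *; first by move: zny; rewrite ltNge z0y.
have [||k kn zky] := IHn; rewrite ?z0y ?ltW //.
by exists k => //; apply: ltnW.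
Qed.

Lemma exists_near_node {R : realType} {c d : R} {n : nat} {z : nat -> R}
    {d1 d2 y : R} :
  irregular_grid c d n z d1 d2 -> c <= y <= d ->
  exists2 k, (k <= n)%N & `|y - z k| < d1.
Proof.
move=> [<- <- _ mesh_le ratio _ [j jn _]] y_in.
have [|k kn /andP[zky yzk]] := exists_mesh_interval _ y_in.
  (* The index [j] of a shortest interval forces [0 < n]. *)
  exact: leq_ltn_trans jn.
have mesh_k := mesh_le _ kn.
(* If [y] is at least [d1] away from the left node, its distance to the right one is at most
   [d2 - d1 < d1]. *)
case: (ltP (y - z k) d1) => far; [exists k | exists k.+1] => //.
- exact: ltnW.
- by rewrite ger0_norm // subr_ge0.
- by rewrite ler0_norm ?subr_le0 //; lra.
Qed.

Theorem proposition2p2 (R : realType) (c d : R) (n : nat) (z : nat -> R)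
    (d1 d2 : R) (hgrid : irregular_grid c d n z d1 d2)
    (m : R) (hm : 0 < m) (eta : R -> R) (heta : class_D m eta)
    (r : nat) (hr : (1 <= r)%N)
    (g : R -> R) (hg : class_C r c d g) (y : R) (hy : y \in `[c, d]) :
  well_defined (Ttilde c d m eta n z d1 r g y).
Proof.
have y_in : c <= y <= d by move: hy; rewrite in_itv.
have [k kn yk] := exists_near_node hgrid y_in.
have d1_gt0 := grid_mesh_gt0 hgrid.
(* The weight of the near node [z k] is split off; the others only need to be nonnegative. *)
rewrite /well_defined /= big_mkord gt_eqF // (bigD1 (Ordinal (kn : (k < n.+1)%N))) //=.
rewrite ltr_pwDl ?sumr_ge0 // => [|i _]; last exact: sigma_of_ge0.
apply: sigma_of_gt0 => //.
(* The factor [2 * m / d1] rescales [|y - z k| < d1] to the bound [2 * m] under which [sigma_of] is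
   positive. *)
rewrite normrM (gtr0_norm (_ : 0 < 2 * m / d1)) ?divr_gt0 ?mulr_gt0 //.
by rewrite mulrAC ltr_pdivrMr // ltr_pM2l ?mulr_gt0.
Qed.
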